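(* Let $t$ be a positive integer. There exist a positive integer $m=m(t)$ (depending only on $t$) and numbers $\varphi(n,t)$ with $\varphi(n,t)=\mathcal{O}(n^{2-\frac1m})$ as $n\to\infty$ such that, for all sufficiently large $n$, every $2$-coloring $E(K_n)=E(R)\cup E(B)$ with $\min\{e(R),e(B)\}\ge \varphi(n,t)$ contains a type-$A$ or a type-$B$ colored copy of $K_{2t}$.
   Context: A $2$-coloring $E(K_n)=E(R)\cup E(B)$ is a partition of the edge set of the complete graph $K_n$ into red edges (forming the graph $R$) and blue edges (forming the graph $B$); $e(R)$ and $e(B)$ denote the numbers of red and blue edges. A $2$-edge-colored complete graph $K_{2t}$ is of type $A$ if the edges of one of the two colors (either red or blue) form a complete graph $K_t$, i.e. there is a set $S$ of $t$ of its vertices such that the edges with both ends in $S$ are exactly the edges of one color. It is of type $B$ if the edges of one of the two colors (either red or blue) form a complete bipartite graph $K_{t,t}$, i.e. there is a partition of its vertices into two sets of size $t$ such that the edges between the two sets are exactly the edges of one color. *)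

(* Defs.v *)
From mathcomp Require Import all_boot.

Set Implicit Arguments.
Unset Strict Implicit.
Unset Printing Implicit Defensive.

(* Edges are two-element sets of vertices, and a graph is given by its edge set;
   [complete_edges W] is E(K_W). *)
Definition complete_edges (V : finType) (W : {set V}) : {set {set V}} :=
  [set e : {set V} | (e \subset W) && (#|e| == 2)].

(* Edges of the complete bipartite graph with (disjoint) sides X and Y. *)
Definition bipartite_edges (V : finType) (X Y : {set V}) : {set {set V}} :=
  [set [set x; y] | x in X, y in Y].

(* Either color class may be empty. *)
Definition two_coloring (V : finType) (W : {set V}) (Red Blue : {set {set V}}) :
    Prop :=
  Red :|: Blue = complete_edges W /\ [disjoint Red & Blue].

Definition type_A (V : finType) (t : nat) (W : {set V})
    (Red Blue : {set {set V}}) : Prop :=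
  exists S : {set V}, [/\ S \subset W, #|S| = t
    & Red = complete_edges S \/ Blue = complete_edges S].

Definition type_B (V : finType) (t : nat) (W : {set V})
    (Red Blue : {set {set V}}) : Prop :=
  exists X Y : {set V}, [/\ X :|: Y = W, [disjoint X & Y], #|X| = t, #|Y| = t
    & Red = bipartite_edges X Y \/ Blue = bipartite_edges X Y].

(* The edges of G having both ends in W. *)
Definition induced (V : finType) (G : {set {set V}}) (W : {set V}) :
    {set {set V}} := [set e in G | e \subset W].

(* A copy of K_2t in the colored complete graph is a set W of 2t vertices,
   carrying the restricted coloring. *)
Definition contains_type_A_or_B (V : finType) (t : nat)
    (Red Blue : {set {set V}}) : Prop :=
  exists W : {set V}, #|W| = 2 * t /\
    (type_A t W (induced Red W) (induced Blue W) \/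
     type_B t W (induced Red W) (induced Blue W)).

(* Main.v *)
Require Import Defs.
From mathcomp Require Import all_boot.
From mathcomp Require Import zify.

Set Implicit Arguments.
Unset Strict Implicit.
Unset Printing Implicit Defensive.

(* By Kovari-Sos-Turan, a color with C n^(2 - 1/(m+1)) edges contains a
   complete bipartite graph with sides of size m.  Ramsey's theorem makes large
   subsets of both sides monochromatic cliques; unless these have the color of
   the bipartite graph, they give a pattern of type A or B.  So if neither
   pattern occurs, both colors contain a large clique.  The two cliques share at
   most one vertex, and between them there is, by pigeonhole, a monochromatic
   K_{t,t}; whichever color it has, it completes a pattern of type A. *)

(** * Ramsey's theorem and its bipartite analogue *)

Definition monochromatic (T : finType) (c : rel T) (b : bool) (S : {set T}) :=
  {in S &, forall x y, x != y -> c x y = b}.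

(** The diagonal is included, so for an irreflexive [c], [joined c true X Y] forces [X] and [Y] to
    be disjoint. *)
Definition joined (T : finType) (c : rel T) (b : bool) (X Y : {set T}) :=
  {in X & Y, forall x y, c x y = b}.

Lemma exists_subset_card (T : finType) (A : {set T}) k :
  k <= #|A| -> exists2 S : {set T}, S \subset A & #|S| = k.
Proof.
rewrite -bin_gt0 -cards_draws card_gt0 => /set0Pn[S].
by rewrite inE => /andP[SA /eqP]; exists S.
Qed.

Lemma monochromatic_sub (T : finType) (c : rel T) b (S A : {set T}) :
  S \subset A -> monochromatic c b A -> monochromatic c b S.
Proof. by move=> /subsetP SA cA x y /SA xA /SA yA; apply: cA. Qed.

Lemma joined_sub (T : finType) (c : rel T) b (X Y X' Y' : {set T}) :
  X' \subset X -> Y' \subset Y -> joined c b X Y -> joined c b X' Y'.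
Proof. by move=> /subsetP XX /subsetP YY cXY x y /XX xX /YY yY; apply: cXY. Qed.

Lemma monochromatic_setU1 (T : finType) (c : rel T) b v (S : {set T}) :
    symmetric c -> monochromatic c b S -> {in S, forall x, c v x = b} ->
  monochromatic c b (v |: S).
Proof.
move=> c_sym cS cv x y /setU1P[->|xS] /setU1P[->|yS]; rewrite ?eqxx //.
- by move=> _; apply: cv.
- by move=> _; rewrite c_sym; apply: cv.
- exact: cS.
Qed.

(** Erdos-Szekeres recursion: among more than [N1 + N2] vertices, any [v] has [N1] neighbors of
    color [true] or [N2] of color [false], and [v] enlarges a clique of that color found among
    them. *)
Lemma ramsey p q : exists N, forall (T : finType) (c : rel T) (A : {set T}),
    symmetric c -> N <= #|A| ->
  exists b, exists2 S : {set T}, S \subset A &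
    #|S| = (if b then p else q) /\ monochromatic c b S.
Proof.
elim: p q => [|p IHp] q.
  exists 0 => T c A _ _; exists true, set0; rewrite ?sub0set // cards0.
  by split=> // x y; rewrite inE.
elim: q => [|q [N2 IHN2]].
  exists 0 => T c A _ _; exists false, set0; rewrite ?sub0set // cards0.
  by split=> // x y; rewrite inE.
have [N1 IHN1] := IHp q.+1.
exists (N1 + N2).+1 => T c A c_sym leA.
have /card_gt0P[v vA] : 0 < #|A| by lia.
pose nbr b := [set x in A :\ v | c v x == b].
have nbrP b (S : {set T}) : S \subset nbr b -> monochromatic c b S ->
    [/\ v |: S \subset A, #|v |: S| = #|S|.+1 & monochromatic c b (v |: S)].
  move=> /subsetP Snbr cS; split.
  - by apply/subsetP=> x /setU1P[->//|/Snbr]; rewrite !inE -andbA => /and3P[].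
  - rewrite cardsU1; suff -> : v \notin S by [].
    by apply/negP=> /Snbr; rewrite !inE eqxx.
  - apply: monochromatic_setU1 => // x /Snbr.
    by rewrite inE => /andP[_ /eqP].
have nbr_sub b : nbr b \subset A.
  by apply/subsetP=> x; rewrite !inE -andbA => /and3P[].
have card_nbr : #|nbr true| + #|nbr false| = #|A|.-1.
  rewrite (cardsD1 v A) vA add1n /= -(cardsID [set x | c v x] (A :\ v)).
  by congr (_ + _); apply: eq_card => x; rewrite !inE; case: (c v x);
    rewrite ?andbT ?andbF.
have [le1|gt1] := leqP N1 #|nbr true|.
  have [[] [S Ssub [Scard cS]]] := IHN1 T c (nbr true) c_sym le1; last first.
    by exists false, S => //; apply: subset_trans Ssub (nbr_sub _).
  by have [? eS ?] := nbrP _ _ Ssub cS; exists true, (v |: S); rewrite ?eS ?Scard.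
have le2 : N2 <= #|nbr false| by lia.
have [[] [S Ssub [Scard cS]]] := IHN2 T c (nbr false) c_sym le2.
  by exists true, S => //; apply: subset_trans Ssub (nbr_sub _).
by have [? eS ?] := nbrP _ _ Ssub cS; exists false, (v |: S); rewrite ?eS ?Scard.
Qed.

(** Fix [2 * t] vertices of [B]. Neighborhoods in them take at most [2 ^ (2 * t)] values, so some
    [t] vertices of [A] share one, [P]; either [P] or its complement has [t] elements. *)
Lemma bipartite_ramsey (T : finType) (c : rel T) t (A B : {set T}) :
    2 ^ (2 * t) * t < #|A| -> 2 * t <= #|B| ->
  exists b (X Y : {set T}), [/\ X \subset A, Y \subset B, #|X| = t, #|Y| = t
    & joined c b X Y].
Proof.
move=> ltA /exists_subset_card[B' B'B cardB'].
pose f x := [set y in B' | c x y].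
have [P PB' leP] : exists2 P : {set T}, P \subset B' & t <= #|[set x in A | f x == P]|.
  apply/exists_inP; apply: contraLR ltA => /exists_inPn small.
  rewrite -leqNgt -cardB' -card_powerset -sum1_card.
  rewrite (partition_big f (mem (powerset B'))) => [|x _]; last first.
    by rewrite /= powersetE; apply/subsetP=> y; rewrite inE => /andP[].
  rewrite -sum_nat_const; apply: leq_sum => P; rewrite /= powersetE => /small.
  rewrite -ltnNge -sum1_card => /ltnW; apply: leq_trans.
  by rewrite leq_eqVlt; apply/orP; left; apply/eqP/eq_bigl => x; rewrite inE.
have [X Xsub cardX] := exists_subset_card leP.
have XA : X \subset A by apply: subset_trans Xsub _; apply/subsetP=> x; rewrite inE => /andP[].
have fX x : x \in X -> f x = P.
  by move/(subsetP Xsub); rewrite inE => /andP[_ /eqP].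
have [b [Q [QB' leQ cQ]]] : exists b (Q : {set T}), [/\ Q \subset B', t <= #|Q|
    & joined c b X Q].
  have [leP'|gtP] := leqP t #|P|.
    exists true, P; split=> // x y xX; rewrite -(fX x xX) inE => /andP[_].
    by [].
  exists false, (B' :\: P); split; first exact: subsetDl.
    by rewrite cardsD (setIidPr PB'); lia.
  move=> x y xX; rewrite -(fX x xX) !inE => /andP[+ yB].
  by rewrite yB /= => /negbTE.
have [Y YQ cardY] := exists_subset_card leQ.
exists b, X, Y; split=> //; first by do 2![apply: subset_trans; last eassumption].
exact: joined_sub cQ.
Qed.

(** * Counting stars: the Kovari-Sos-Turan bound *)

Lemma leq_ffact a m : (a - m) ^ m <= a ^_ m.
Proof.
elim: m a => [|m IHm] a; first by rewrite ffactn0.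
case: a => [|a]; first by rewrite sub0n exp0n.
rewrite subSS ffactnS expnS leq_mul //; lia.
Qed.

Lemma ffact_leq_exp a m : a ^_ m <= a ^ m.
Proof.
elim: m a => [|m IHm] a; first by rewrite ffactn0.
rewrite ffactnS expnS leq_mul // (leq_trans (IHm _)) //.
by case: (posnP m) => [->//|m0]; rewrite leq_exp2r // leq_pred.
Qed.

(* Counts pairs of a vertex and an m-subset of its neighborhood.  Only the
   vertices of at least half the average degree are used, which loses a constant
   factor but avoids any convexity argument. *)
Lemma kovari_sos_turan (T : finType) (r : rel T) m
    (e := \sum_x #|[set y | r x y]|) :
    4 * #|T| * m <= e ->
    2 * m * 4 ^ m * #|T| ^ (2 * m).+1 < e ^ m.+1 ->
  exists X Y : {set T}, [/\ #|X| = m, #|Y| = m & joined r true X Y].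
Proof.
move=> le_e lt_e; pose nbr x := [set y | r x y].
(* Either some [m]-set has [m] common neighbors, which is the goal, or every [m]-set has fewer,
   which will bound [e] from above. *)
have [/existsP[Y /andP[/eqP cardY leY]]|] :=
    boolP [exists Y : {set T}, (#|Y| == m) && (m <= #|[set x | Y \subset nbr x]|)].
  have [X /subsetP XY cardX] := exists_subset_card leY.
  exists X, Y; split=> // x y /XY; rewrite inE => /subsetP Yx /Yx.
  by rewrite inE.
move=> /existsPn small; move: lt_e; rewrite ltnNge => /negP[].
(* Falling factorials count ordered stars; summing over the leaf set [Y] instead, each [m]-set has
   fewer than [m] centers. *)
have count_stars : \sum_x #|nbr x| ^_ m <= m * #|T| ^ m.
  have -> : \sum_x #|nbr x| ^_ m =
      (\sum_(Y : {set T} | #|Y| == m) #|[set x | Y \subset nbr x]|) * m`!.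
    rewrite big_distrl /=.
    under eq_bigr do rewrite -bin_ffact -cards_draws -sum1_card.
    rewrite -!big_distrl /=; congr (_ * _).
    rewrite (exchange_big_dep (fun Y : {set T} => #|Y| == m)) /=; last first.
      by move=> x Y _; rewrite inE => /andP[].
    apply: eq_bigr => Y Ym; rewrite -sum1_card; apply: eq_bigl => x.
    by rewrite !inE Ym andbT.
  apply: (@leq_trans (('C(#|T|, m) * m) * m`!)).
    rewrite leq_mul2r; apply/orP; right.
    rewrite -card_draws -sum_nat_const.
    under [leqRHS]eq_bigl do rewrite inE.
    apply: leq_sum => Y Ym.
    by have := small Y; rewrite Ym /= -ltnNge => /ltnW.
  rewrite mulnAC bin_ffact mulnC leq_mul2l ffact_leq_exp orbT //.
pose H := [set x | e <= 2 * #|T| * #|nbr x|].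
(* Vertices outside [H] account for at most [e / 2], so [H] carries the other half, at no more than
   [#|T|] per vertex. *)
have card_H : e <= 2 * #|T| * #|H|.
  have le_small : 2 * #|T| * \sum_(x | x \notin H) #|nbr x| <= #|T| * e.
    rewrite big_distrr /= -sum_nat_const; apply: leq_trans (_ : \sum_(x | x \notin H) e <= _).
      by apply: leq_sum => x; rewrite inE -ltnNge => /ltnW.
    by rewrite [leqRHS](bigID (mem H)) /= leq_addl.
  have le_large : \sum_(x in H) #|nbr x| <= #|H| * #|T|.
    by rewrite -sum_nat_const; apply: leq_sum => x _; apply: max_card.
  have e_split : e = \sum_(x in H) #|nbr x| + \sum_(x | x \notin H) #|nbr x|.
    by rewrite /e (bigID (mem H)).
  have [T0|T0] := posnP #|T|.
    suff : e <= 0 by lia.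
    have := le_large; rewrite T0 muln0 leqn0 e_split => /eqP->.
    rewrite leqn0 sum_nat_eq0; apply/forall_inP => x.
    by have /card0_eq/(_ x) := T0.
  rewrite -(leq_pmul2l T0); nia.
(* From [4 * #|T| * m <= e] and the definition of [H], [4 * #|T| * (#|nbr x| - m)] is at least
   [2 * e - e]. *)
have deg_H x : x \in H -> e ^ m <= (4 * #|T|) ^ m * #|nbr x| ^_ m.
  rewrite inE => xH; apply: (@leq_trans ((4 * #|T| * (#|nbr x| - m)) ^ m)).
    by case: (posnP m) => [->//|m0]; rewrite leq_exp2r //; nia.
  by rewrite expnMn leq_mul2l leq_ffact orbT.
have le_sum : #|H| * e ^ m <= (4 * #|T|) ^ m * (m * #|T| ^ m).
  apply: (@leq_trans ((4 * #|T|) ^ m * \sum_x #|nbr x| ^_ m)); last first.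
    by rewrite leq_mul2l count_stars orbT.
  rewrite -sum_nat_const big_distrr /= [leqRHS](bigID (mem H)) /=.
  by apply: leq_trans (leq_addr _ _); apply: leq_sum.
apply: (@leq_trans (2 * #|T| * #|H| * e ^ m)).
  by rewrite expnS leq_mul2r card_H orbT.
rewrite -mulnA; apply: leq_trans (leq_mul (leqnn _) le_sum) _.
rewrite expnMn expnS (mulnC 2 m) expnM -mulnn.
by move: (4 ^ m) (#|T| ^ m) => a b; lia.
Qed.

(** * From edge sets to a boolean color relation *)

Definition adjacent (T : finType) (G : {set {set T}}) : rel T :=
  fun x y => [set x; y] \in G.

Lemma adjacentC (T : finType) (G : {set {set T}}) : symmetric (adjacent G).
Proof. by move=> x y; rewrite /adjacent setUC. Qed.

Lemma in_complete_edges (T : finType) (S : {set T}) x y :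
  x != y -> ([set x; y] \in complete_edges S) = (x \in S) && (y \in S).
Proof. by move=> xy; rewrite inE subUset !sub1set cards2 xy andbT. Qed.

Lemma in_bipartite_edges (T : finType) (X Y : {set T}) x y :
  ([set x; y] \in bipartite_edges X Y) =
    (x \in X) && (y \in Y) || (y \in X) && (x \in Y).
Proof.
apply/imset2P/orP => [[a b aX bY xy_ab]|[]/andP[xX yY]]; last 2 first.
- by exists x y.
- by exists y x => //; rewrite setUC.
have: x \in [set a; b] by rewrite -xy_ab set21.
have: y \in [set a; b] by rewrite -xy_ab set22.
have: a \in [set x; y] by rewrite xy_ab set21.
have: b \in [set x; y] by rewrite xy_ab set22.
by move=> /set2P[?|?] /set2P[?|?] /set2P[?|?] /set2P[?|?]; subst;
  first [by left; rewrite aX bY | by right; rewrite aX bY].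
Qed.

Lemma sub_complete_edges (T : finType) (S W : {set T}) :
  S \subset W -> complete_edges S \subset complete_edges W.
Proof.
move=> SW; apply/subsetP=> e; rewrite !inE => /andP[eS ->].
by rewrite (subset_trans eS SW).
Qed.

Lemma sub_bipartite_edges (T : finType) (X Y : {set T}) :
  [disjoint X & Y] -> bipartite_edges X Y \subset complete_edges (X :|: Y).
Proof.
move=> dXY; apply/subsetP=> _ /imset2P[x y xX yY ->].
have xy : x != y by apply: contraTneq yY => <-; rewrite (disjointFr dXY xX).
by rewrite in_complete_edges // !inE xX yY orbT.
Qed.

(** Lets [adjacent Red] alone encode the coloring, with [true] for red and [false] for blue; loops
    belong to neither color, hence [x != y]. *)
Lemma adjacent_color (T : finType) (Red Blue : {set {set T}}) b x y :
    two_coloring setT Red Blue -> x != y ->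
  adjacent (if b then Red else Blue) x y = (adjacent Red x y == b).
Proof.
move=> [RB dRB] xy; rewrite /adjacent; case: b; first by rewrite eqb_id.
have: [set x; y] \in Red :|: Blue by rewrite RB in_complete_edges // !inE.
by rewrite inE; case: (boolP (_ \in Red)) => [/(disjointFr dRB)->|_ /= ->].
Qed.

Lemma color_sub (T : finType) (Red Blue : {set {set T}}) (b : bool) :
    two_coloring setT Red Blue ->
  (if b then Red else Blue) \subset complete_edges setT.
Proof. by case=> <- _; case: b; rewrite ?subsetUl ?subsetUr. Qed.

(** Both sides contain only two-element subsets of [W], so comparing them on pairs of distinct
    vertices is enough. *)
Lemma induced_color (T : finType) (Red Blue : {set {set T}}) b
    (W : {set T}) (F : {set {set T}}) :
    two_coloring setT Red Blue -> F \subset complete_edges W ->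
    {in W &, forall x y, x != y ->
      (adjacent Red x y == b) = ([set x; y] \in F)} ->
  induced (if b then Red else Blue) W = F.
Proof.
move=> col FW RF; apply/setP=> e; rewrite inE.
have [/andP[eW /cards2P[x [y [xy e_xy]]]]|] :=
    boolP ((e \subset W) && (#|e| == 2)).
  rewrite eW andbT; move: eW; rewrite e_xy subUset !sub1set => /andP[xW yW].
  by rewrite -RF // -(adjacent_color _ col).
move=> eNW; apply/andP/idP => [[eG eW]|/(subsetP FW)]; last first.
  by rewrite inE (negPf eNW).
move/(subsetP (color_sub b col)): eG; rewrite inE subsetT /= => e2.
by rewrite eW e2 in eNW.
Qed.

(** * Recognizing the two patterns *)

Lemma contains_type_A (T : finType) (Red Blue : {set {set T}}) t p
    (X Y : {set T}) :
    two_coloring setT Red Blue -> #|X| = t -> #|Y| = t -> [disjoint X & Y] ->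
    monochromatic (adjacent Red) p X -> monochromatic (adjacent Red) (~~ p) Y ->
    joined (adjacent Red) (~~ p) X Y ->
  contains_type_A_or_B t Red Blue.
Proof.
move=> col Xt Yt dXY cX cY cXY; exists (X :|: Y); split.
  by rewrite cardsU disjoint_setI0 // cards0 subn0 Xt Yt addnn mul2n.
left; exists X; split=> //; first exact: subsetUl.
suff: induced (if p then Red else Blue) (X :|: Y) = complete_edges X.
  by case: (p); [left | right].
apply: induced_color col _ _; first exact/sub_complete_edges/subsetUl.
move=> x y /setUP[] xW /setUP[] yW xy; rewrite in_complete_edges //.
- by rewrite cX // xW yW eqxx.
- by rewrite cXY // xW (disjointFl dXY yW); case: (p).
- by rewrite adjacentC cXY // yW (disjointFl dXY xW); case: (p).
- by rewrite cY // (disjointFl dXY xW); case: (p).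
Qed.

Lemma contains_type_B (T : finType) (Red Blue : {set {set T}}) t p
    (X Y : {set T}) :
    two_coloring setT Red Blue -> #|X| = t -> #|Y| = t -> [disjoint X & Y] ->
    monochromatic (adjacent Red) (~~ p) X ->
    monochromatic (adjacent Red) (~~ p) Y ->
    joined (adjacent Red) p X Y ->
  contains_type_A_or_B t Red Blue.
Proof.
move=> col Xt Yt dXY cX cY cXY; exists (X :|: Y); split.
  by rewrite cardsU disjoint_setI0 // cards0 subn0 Xt Yt addnn mul2n.
right; exists X, Y; split=> //.
suff: induced (if p then Red else Blue) (X :|: Y) = bipartite_edges X Y.
  by case: (p); [left | right].
apply: induced_color col (sub_bipartite_edges dXY) _.
move=> x y /setUP[] xW /setUP[] yW xy; rewrite in_bipartite_edges //.
- by rewrite cX // (disjointFr dXY xW) (disjointFr dXY yW) !andbF; case: (p).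
- by rewrite cXY // xW yW eqxx.
- by rewrite adjacentC cXY // xW yW eqxx orbT.
- by rewrite cY // (disjointFl dXY xW) (disjointFl dXY yW); case: (p).
Qed.

Lemma joinedC (T : finType) (c : rel T) b (X Y : {set T}) :
  symmetric c -> joined c b X Y -> joined c b Y X.
Proof. by move=> c_sym cXY y x yY xX; rewrite c_sym cXY. Qed.

(** If exactly one of [p], [q] differs from [r], the clique of that color is the only part of its
    color: type A. If both differ, color [r] is exactly the bipartite graph: type B. Only a fully
    monochromatic union is excluded. *)
Lemma contains_pattern (T : finType) (Red Blue : {set {set T}}) t p q r
    (X Y : {set T}) :
    two_coloring setT Red Blue -> #|X| = t -> #|Y| = t -> [disjoint X & Y] ->
    monochromatic (adjacent Red) p X -> monochromatic (adjacent Red) q Y ->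
    joined (adjacent Red) r X Y -> ~~ ((p == r) && (q == r)) ->
  contains_type_A_or_B t Red Blue.
Proof.
move=> col Xt Yt dXY cX cY cXY.
have [p_r /= qr|pr _] := eqVneq p r; last first.
  have [qr|qr] := eqVneq q r.
    apply: (contains_type_A (p := p) col Xt Yt) => //.
      by move: cY; rewrite qr; case: (p) (r) pr => [] [].
    by move: cXY; case: (p) (r) pr => [] [].
  apply: (contains_type_B (p := r) col Xt Yt) => //.
    by move: cX; case: (p) (r) pr => [] [].
  by move: cY; case: (q) (r) qr => [] [].
apply: (contains_type_A (p := q) col Yt Xt) => //.
- by rewrite disjoint_sym.
- by move: cX; rewrite p_r; case: (q) (r) qr => [] [].
- apply: joinedC; first exact: adjacentC.
  by move: cXY; case: (q) (r) qr => [] [].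
Qed.

(** * Dense colors and large cliques *)

(** Ordered adjacent pairs map onto the edges, two to one; the factor 2 is given up. *)
Lemma card_edges_le_sum_degree (T : finType) (Red Blue : {set {set T}})
    (b : bool) (G := if b then Red else Blue) :
  two_coloring setT Red Blue -> #|G| <= \sum_x #|[set y | adjacent G x y]|.
Proof.
move=> col.
have -> : \sum_x #|[set y | adjacent G x y]| =
    #|[set xy : T * T | adjacent G xy.1 xy.2]|.
  rewrite -sum1_card; under eq_bigr do rewrite -sum1_card.
  by rewrite pair_big_dep /=; apply: eq_bigl => xy; rewrite !inE.
apply: leq_trans (leq_imset_card (fun xy : T * T => [set xy.1; xy.2]) _).
apply/subset_leq_card/subsetP=> e eG.
have := subsetP (color_sub b col) e eG.
rewrite inE => /andP[_ /cards2P[x [y [xy e_xy]]]].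
by apply/imsetP; exists (x, y); rewrite ?inE /= /adjacent -?e_xy.
Qed.

(** The Ramsey property is a hypothesis so that [m] can be both the side of the bipartite graph and
    a Ramsey number for [s]. *)
Lemma dense_color_clique (T : finType) (Red Blue : {set {set T}}) b m s t
    (G := if b then Red else Blue) :
    (forall (c : rel T) (A : {set T}), symmetric c -> m <= #|A| ->
       exists b, exists2 S : {set T}, S \subset A &
         #|S| = s /\ monochromatic c b S) ->
    t <= s -> two_coloring setT Red Blue ->
    4 * #|T| * m <= #|G| ->
    2 * m * 4 ^ m * #|T| ^ (2 * m).+1 < #|G| ^ m.+1 ->
  contains_type_A_or_B t Red Blue \/
  exists S : {set T}, #|S| = s /\ monochromatic (adjacent Red) b S.
Proof.
move=> ramsey_m ts col le_G lt_G.
have le_e := card_edges_le_sum_degree b col.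
have [X [Y [Xm Ym GXY]]] : exists X Y : {set T},
    [/\ #|X| = m, #|Y| = m & joined (adjacent G) true X Y].
  apply: kovari_sos_turan; first exact: leq_trans le_e.
  by apply: leq_trans lt_G _; rewrite leq_exp2r.
have neqXY x y : x \in X -> y \in Y -> x != y.
  move=> xX yY; have /(subsetP (color_sub b col)) := GXY x y xX yY.
  by rewrite inE cards2 => /andP[_]; case: (x != y).
have cXY : joined (adjacent Red) b X Y.
  move=> x y xX yY; have := GXY x y xX yY.
  by rewrite (adjacent_color _ col) ?neqXY // => /eqP.
have [|p [X' X'X [X's cX']]] := ramsey_m _ X (adjacentC Red); first by rewrite Xm.
have [|q [Y' Y'Y [Y's cY']]] := ramsey_m _ Y (adjacentC Red); first by rewrite Ym.
have [/andP[/eqP pb _]|npq] := boolP ((p == b) && (q == b)).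
  by right; exists X'; rewrite -pb.
left; have [|X1 X1X' X1t] := @exists_subset_card _ X' t; first by rewrite X's.
have [|Y1 Y1Y' Y1t] := @exists_subset_card _ Y' t; first by rewrite Y's.
have X1X := subset_trans X1X' X'X; have Y1Y := subset_trans Y1Y' Y'Y.
apply: (contains_pattern (p := p) (q := q) (r := b) col X1t Y1t) => //.
- rewrite disjoint_subset; apply/subsetP=> x /(subsetP X1X) xX.
  by rewrite inE; apply/negP=> /(subsetP Y1Y) /(neqXY _ _ xX); rewrite eqxx.
- exact: monochromatic_sub cX'.
- exact: monochromatic_sub cY'.
- exact: joined_sub cXY.
Qed.

Lemma unavoidable_patterns t : exists m, 0 < m /\
  forall (T : finType) (Red Blue : {set {set T}}),
    two_coloring setT Red Blue ->
    4 * #|T| * m <= minn #|Red| #|Blue| ->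
    2 * m * 4 ^ m * #|T| ^ (2 * m).+1 < minn #|Red| #|Blue| ^ m.+1 ->
  contains_type_A_or_B t Red Blue.
Proof.
(* Large enough that [A] meets the strict bound of [bipartite_ramsey] and [B] keeps [2 * t] vertices
   after losing one shared with [A]. *)
pose s := (2 ^ (2 * t) * t + 2 * t).+1.
have [N ramseyN] := ramsey s s.
(* The successor secures [0 < m]; the Ramsey property persists for larger sets. *)
exists N.+1; split=> // T Red Blue col le_e lt_e.
have dense b : contains_type_A_or_B t Red Blue \/
    exists S : {set T}, #|S| = s /\ monochromatic (adjacent Red) b S.
  have leG : minn #|Red| #|Blue| <= #|if b then Red else Blue|.
    by case: b; rewrite ?geq_minl ?geq_minr.
  apply: (dense_color_clique (m := N.+1)) => //.
  - move=> c A c_sym /ltnW /(ramseyN _ c _ c_sym)[p [S SA [Ss cS]]].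
    by exists p, S => //; split=> //; rewrite Ss; case: (p).
  - by rewrite /s; lia.
  - exact: leq_trans le_e _.
  - by apply: leq_trans lt_e _; rewrite leq_exp2r.
have [//|[A [As cA]]] := dense true.
have [//|[B [Bs cB]]] := dense false.
(* Two common vertices would span an edge that is both red and blue. *)
have cardAB : #|A :&: B| <= 1.
  rewrite leqNgt; apply/negP=> /card_gt1P[x [y [/setIP[xA xB] /setIP[yA yB] xy]]].
  by have := cB x y xB yB xy; rewrite cA.
have leB : 2 * t <= #|B :\: A| by rewrite cardsD setIC Bs; rewrite /s; lia.
have ltA : 2 ^ (2 * t) * t < #|A| by rewrite As /s; lia.
have [b [X [Y [XA YB Xt Yt cXY]]]] :=
  bipartite_ramsey (adjacent Red) ltA leB.
apply: (contains_pattern (p := true) (q := false) (r := b) col Xt Yt) => //.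
- apply: disjointWl XA _; apply: disjointWr YB _.
  by rewrite disjoint_sym disjoints_subset; apply/subsetP=> x; rewrite !inE => /andP[].
- exact: monochromatic_sub cA.
- by apply: monochromatic_sub cB; apply: subset_trans YB (subsetDl _ _).
(* The cliques have opposite colors, so [b] cannot agree with both. *)
- by case: b {cXY}.
Qed.

(* The real-valued threshold and its growth *)
From mathcomp Require Import all_boot all_order all_algebra.
From mathcomp Require Import all_classical all_reals all_analysis.
Import Order.TTheory GRing.Theory Num.Theory numFieldNormedType.Exports.
Local Open Scope classical_set_scope.
Local Open Scope ring_scope.

(** The exponent is at least 1, which gives the linear bound for [n >= 1]; multiplied by [m.+1] it
    becomes the integer [2 * m + 1], which gives the other. *)
Lemma powR_lower_bound (R : realType) (m C n e : nat) : (0 < n)%N ->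
    C%:R * n%:R `^ (2 - m.+1%:R^-1) <= e%:R :> R ->
  (C * n <= e)%N /\ (C ^ m.+1 * n ^ (2 * m).+1 <= e ^ m.+1)%N.
Proof.
move=> n_gt0 le_e; have n_ge1 : 1 <= n%:R :> R by rewrite ler1n.
split; rewrite -(ler_nat R).
  rewrite natrM; apply: le_trans le_e; apply: ler_wpM2l; first exact: ler0n.
  rewrite -[leLHS]powRr1 ?ler0n // ler_powR // lerBrDr (natrD _ 1 1) lerD2l.
  by rewrite invf_le1 ?ltr0n // ler1n.
have -> : (C ^ m.+1 * n ^ (2 * m).+1)%:R =
    (C%:R * n%:R `^ (2 - m.+1%:R^-1)) ^+ m.+1 :> R.
  rewrite exprMn natrM !natrX; congr (_ * _).
  rewrite -[RHS]powR_mulrn ?powR_ge0 // -powRrM mulrBl mulVf ?pnatr_eq0 //.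
  by rewrite -natrM mulnS add2n -natr1 addrK powR_mulrn ?ler0n.
by rewrite natrX; apply: lerXn2r le_e; rewrite nnegrE ?mulr_ge0 ?powR_ge0.
Qed.

Theorem theorem2p1 (R : realType) (t : nat) (t_gt0 : (0 < t)%N) :
  exists (m : nat) (phi : nat -> R),
    [/\ (0 < m)%N,
        phi =O_\oo (fun n : nat => n%:R `^ (2 - m%:R^-1) : R)
      & \forall n \near \oo, forall Red Blue : {set {set 'I_n}},
          two_coloring [set: 'I_n]%SET Red Blue ->
          phi n <= (minn #|Red| #|Blue|)%:R ->
          contains_type_A_or_B t Red Blue].
Proof.
have [m [m_gt0 patterns]] := unavoidable_patterns t.
(* One constant serves both hypotheses of [patterns]: [4 * m <= C], and
   [2 * m * 4 ^ m < C <= C ^ m.+1] because [m] is positive. *)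
pose C := (2 * m * 4 ^ m + 4 * m)%N.
exists m.+1, (fun n => C%:R * n%:R `^ (2 - m.+1%:R^-1)); split=> //.
  (* Adding 1 makes the big-O constant visibly positive. *)
  apply/eqO_exP; exists (C%:R + 1); first by rewrite ltr_wpDl.
  apply: nearW => n; rewrite normrM normr_nat ler_wpM2r // lerDl //.
exists 1%N => // n /= n_gt0 Red Blue col /(powR_lower_bound n_gt0)[le1 le2].
apply: patterns col _ _; rewrite card_ord.
  by apply: leq_trans le1; rewrite /C; lia.
apply: leq_trans le2; rewrite ltn_pmul2r ?expn_gt0 ?n_gt0 //.
apply: (@leq_trans C); first by rewrite /C; lia.
by rewrite expnS leq_pmulr // expn_gt0 /C; lia.
Qed.
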